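(* Let $G=(V,E)$ be a finite graph with at least one vertex and let $w\ge k>0$ be integers. The following are equivalent: (i) $G$ has an $\mathcal F^w_k$-tangle of $S_k$; (ii) $G$ has no $S_k$-tree over $\mathcal F^w_k$; (iii) $G$ has no tree-decomposition of width $<w-1$ and adhesion $<k$.
   Context: An (oriented vertex) separation of $G$ is a pair $(A,B)$ of (possibly empty) subsets of $V$ with $A\cup B=V$ and no edge between $A\setminus B$ and $B\setminus A$, ordered by $(A,B)\le(C,D)$ iff $A\subseteq C$, $B\supseteq D$, with inverse $(B,A)$; $\{A,B\}$ is the unoriented separation, of order $|A\cap B|$. $\vec S_k$: oriented separations of order $<k$; $S_k$: unoriented ones. An orientation of $S_k$ is a set $O\subseteq\vec S_k$ containing exactly one of $(A,B),(B,A)$ for each $\{A,B\}\in S_k$; it is consistent if there are no $(A,B),(C,D)\in\vec S_k$ with $\{A,B\}\ne\{C,D\}$, $(A,B)<(C,D)$, $(B,A)\in O$, $(C,D)\in O$. A star is a set $\sigma$ with $(A,B)\ne(B,A)$ for each element and $(A,B)\le(D,C)$ for distinct $(A,B),(C,D)\in\sigma$. $\mathcal F^w_k$ is the set of stars $\{(A_i,B_i):i=0,\dots,n\}\subseteq\vec S_k$ with $|\bigcap_{i=0}^nB_i|<w$ (intersection $=V$ for the empty star). An $\mathcal F^w_k$-tangle of $S_k$ is a consistent orientation of $S_k$ with no subset in $\mathcal F^w_k$. An $S_k$-tree over $\mathcal F^w_k$ is a pair $(T,\alpha)$, $T$ a finite tree with at least one node, $\alpha$ assigning to each ordered pair $(x,y)$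 with $xy\in E(T)$ an element $\alpha(x,y)\in\vec S_k$ with $\alpha(y,x)$ the inverse of $\alpha(x,y)$ and $\{\alpha(x,t):xt\in E(T)\}\in\mathcal F^w_k$ for every node $t$. The adhesion of a tree-decomposition $(T,(V_t)_{t\in T})$ is $\max_{st\in E(T)}|V_s\cap V_t|$ (and $0$ if $T$ has one node); its width is $\max_t|V_t|-1$. *)

(* Defs.v *)
From mathcomp Require Import all_boot all_order all_algebra.

Set Implicit Arguments.
Unset Strict Implicit.
Unset Printing Implicit Defensive.

Record sgraph := SGraph {
  vertex :> finType;
  edge : rel vertex;
  edge_sym : symmetric edge;
  edge_irrefl : irreflexive edge
}.

Section Trees.
Variable T : sgraph.

Definition connected_graph : Prop := forall x y : T, connect (@edge T) x y.

(* [cycle] accepts the closed walk x, y, x along a single edge as a cycle of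
   size 2; genuine graph cycles have at least three vertices. *)
Definition acyclic_graph : Prop :=
  forall c : seq T, 2 < size c -> ~ ucycle (@edge T) c.

Definition is_tree : Prop := [/\ 0 < #|T|, connected_graph & acyclic_graph].

End Trees.

Section Separations.
Variable G : sgraph.

Definition sep : finType := ({set G} * {set G})%type.

Implicit Types (r s : sep) (O sigma : {set sep}).

Definition is_sep s : bool :=
  (s.1 :|: s.2 == [set: G]) &&
  [forall x in s.1 :\: s.2, forall y in s.2 :\: s.1, ~~ edge x y].

Definition sep_order s : nat := #|s.1 :&: s.2|.

Definition sep_inv s : sep := (s.2, s.1).

(* The unoriented separation {A, B}, as a set with at most two elements. *)
Definition unoriented s : {set {set G}} := [set s.1; s.2].

Definition sep_le r s : bool := (r.1 \subset s.1) && (s.2 \subset r.2).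

Definition sep_lt r s : bool := sep_le r s && (r != s).

Definition seps_lt (k : nat) : {set sep} :=
  [set s | is_sep s && (sep_order s < k)].

(* "Exactly one" counts elements of the set {(A,B), (B,A)}: an orientation
   must contain the degenerate separation (V,V) when it has order < k. *)
Definition orientation (k : nat) O : Prop :=
  O \subset seps_lt k /\
  forall s, s \in seps_lt k -> #|O :&: [set s; sep_inv s]| = 1.

Definition consistent (k : nat) O : Prop :=
  ~ exists r s, [/\ r \in seps_lt k /\ s \in seps_lt k,
                    unoriented r != unoriented s,
                    sep_lt r s, sep_inv r \in O & s \in O].

Definition star sigma : Prop :=
  (forall s, s \in sigma -> s <> sep_inv s) /\
  (forall r s, r \in sigma -> s \in sigma -> r <> s -> sep_le r (sep_inv s)).

(* [\bigcap] over the empty star is [set: G]. *)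
Definition in_F (w k : nat) sigma : Prop :=
  [/\ star sigma, sigma \subset seps_lt k & #|\bigcap_(s in sigma) s.2| < w].

Definition F_tangle (w k : nat) O : Prop :=
  [/\ orientation k O, consistent k O &
      ~ exists sigma, sigma \subset O /\ in_F w k sigma].

(* Only the values of [alpha] on adjacent pairs of nodes matter. *)
Definition S_tree_over_F (w k : nat) (T : sgraph) (alpha : T -> T -> sep)
    : Prop :=
  [/\ is_tree T,
      forall x y : T, edge x y ->
        alpha x y \in seps_lt k /\ alpha y x = sep_inv (alpha x y) &
      forall t : T, in_F w k [set alpha x t | x : T & edge x t]].

End Separations.

Section TreeDecompositions.
Variables (G T : sgraph) (bag : T -> {set G}).

(* In the last clause, t2 lies on the path in T from t1 to t3, whose
   sequence of nodes is t1 :: p. *)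
Definition tree_decomposition : Prop :=
  [/\ is_tree T,
      \bigcup_(t : T) bag t = [set: G],
      forall x y : G, edge x y -> exists t : T, x \in bag t /\ y \in bag t &
      forall (t1 t2 t3 : T) (p : seq T),
        path (@edge T) t1 p -> last t1 p = t3 -> uniq (t1 :: p) ->
        t2 \in t1 :: p -> bag t1 :&: bag t3 \subset bag t2].

Definition adhesion : nat :=
  \max_(p : T * T | edge p.1 p.2) #|bag p.1 :&: bag p.2|.

(* Integer-valued, to avoid truncated subtraction. *)
Definition width : int := ((\max_(t : T) #|bag t|)%N%:Z - 1)%R.

End TreeDecompositions.

(* Main.v *)
Require Import Defs.
From mathcomp Require Import all_boot all_order all_algebra.
From mathcomp Require Import zify.
From Stdlib Require Import Classical.

Set Implicit Arguments.
Unset Strict Implicit.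
Unset Printing Implicit Defensive.

(* Duality.  Call a separation small if its first side has a tree-decomposition
   into parts of size < w with adhesion < k whose root part contains the
   separator.  If no separation and its inverse are both small (otherwise glue the
   two decompositions), a tangle is grown greedily.  Let P be a down-closed partial
   orientation whose members are declared small.  If s is not yet oriented, take
   r1 <= s and r2 <= s^-1 minimal outside P.  Were neither r1 nor r2 addable to P,
   re-rooting the resulting decompositions would make both r1^-1 and r2^-1 small
   over P.  Take u of minimum order with r1 <= u <= r2^-1: by submodularity both
   decompositions can be shifted to u, so that u and u^-1 are small over P, a
   contradiction.  A maximal P is thus a total orientation, hence a tangle.

   The converse directions are direct: the sides of the edges of a
   tree-decomposition form an S_k-tree, and a tangle would orient the edges of an
   S_k-tree so that every node has an outgoing edge, which is impossible in a
   finite tree. *)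

(** * Separations *)

Section SeparationLattice.
Variable G : sgraph.
Implicit Types (r s u v : sep G) (W : {set G}).

Lemma is_sepP s :
  reflect ((forall x, (x \in s.1) || (x \in s.2)) /\
           (forall x y, edge x y ->
              (x \in s.1) && (y \in s.1) || (x \in s.2) && (y \in s.2)))
          (is_sep s).
Proof.
apply: (iffP andP) => -[].
  move=> /eqP cov /forall_inP noE.
  have {}cov x : (x \in s.1) || (x \in s.2) by rewrite -in_setU cov inE.
  split=> // x y exy; move: (cov x) (cov y).
  move: (noE x) (noE y); rewrite !inE.
  move=> Hx Hy.
  case x1: (x \in s.1) Hx Hy; case x2: (x \in s.2);
  case y1: (y \in s.1); case y2: (y \in s.2) => //= Hx Hy _ _.
  - by have /forall_inP/(_ y) := Hx isT; rewrite !inE y1 y2 exy => /(_ isT).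
  - by have /forall_inP/(_ x) := Hy isT;
      rewrite !inE x1 x2 edge_sym exy => /(_ isT).
move=> cov in_side; split; first by apply/eqP/setP => x; rewrite !inE cov.
apply/forall_inP => x; rewrite inE => /andP[x2 _].
apply/forall_inP => y; rewrite inE => /andP[y1 _].
by apply/negP => /in_side; rewrite (negPf x2) (negPf y1) andbF.
Qed.

Definition sep_meet r s : sep G := (r.1 :&: s.1, r.2 :|: s.2).

Definition sep_join r s : sep G := (r.1 :|: s.1, r.2 :&: s.2).

Lemma sep_invK : involutive (@sep_inv G).
Proof. by case. Qed.

Lemma sep_le_refl s : sep_le s s.
Proof. by rewrite /sep_le !subxx. Qed.

Lemma sep_le_trans u r s : sep_le r u -> sep_le u s -> sep_le r s.
Proof.
by move=> /andP[a b] /andP[c d]; rewrite /sep_le (subset_trans a c) (subset_trans d b).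
Qed.

Lemma sep_le_inv r s : sep_le (sep_inv r) (sep_inv s) = sep_le s r.
Proof. by rewrite /sep_le andbC. Qed.

Lemma sep_order_inv s : sep_order (sep_inv s) = sep_order s.
Proof. by rewrite /sep_order setIC. Qed.

Lemma is_sep_inv s : is_sep (sep_inv s) = is_sep s.
Proof.
have inv_sep r : is_sep r -> is_sep (sep_inv r).
  move=> /is_sepP[cov in_side]; apply/is_sepP; split=> [x|x y /in_side].
    by rewrite orbC.
  by rewrite orbC.
by apply/idP/idP => /inv_sep; rewrite ?sep_invK.
Qed.

Lemma is_sep_meet r s : is_sep r -> is_sep s -> is_sep (sep_meet r s).
Proof.
move=> /is_sepP[cov1 side1] /is_sepP[cov2 side2]; apply/is_sepP.
split=> [x|x y exy]; rewrite !inE.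
  by move: (cov1 x) (cov2 x); do 4!case: (_ \in _).
by move: (side1 _ _ exy) (side2 _ _ exy); do 8!case: (_ \in _).
Qed.

Lemma is_sep_addl s W : is_sep s -> is_sep (s.1 :|: W, s.2).
Proof.
move=> /is_sepP[cov side]; apply/is_sepP.
split=> [x|x y exy]; rewrite !inE.
  by rewrite orbAC cov.
by move: (side _ _ exy); do 6!case: (_ \in _).
Qed.

(** The separators of meet and join have their union inside the union of the two given separators,
    and likewise for intersections. *)
Lemma sep_order_submod r s :
  sep_order (sep_meet r s) + sep_order (sep_join r s) <= sep_order r + sep_order s.
Proof.
rewrite /sep_order -cardsUI -[leqRHS]cardsUI leq_add ?subset_leq_card //.
  by apply/subsetP => x; rewrite !inE; do 4!case: (_ \in _).
by apply/subsetP => x; rewrite !inE; do 4!case: (_ \in _).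
Qed.

Lemma seps_lt_inv k s : (sep_inv s \in seps_lt G k) = (s \in seps_lt G k).
Proof. by rewrite !inE is_sep_inv sep_order_inv. Qed.

(** Only (V,V) equals its inverse, and its order |V| is at least [k]. *)
Lemma sep_inv_neq k s : k <= #|G| -> s \in seps_lt G k -> s <> sep_inv s.
Proof.
case: s => A B k_le; rewrite inE => /andP[/is_sepP[/= cov _]] ord [eqAB _].
move: ord; rewrite /sep_order /= -{}eqAB setIid in cov *.
suff ->: A = [set: G] by rewrite cardsT ltnNge k_le.
by apply/setP => x; have := cov x; rewrite orbb inE.
Qed.

(** The minimality that lets a decomposition be shifted to [u] without raising any order. *)
Definition linked r u :=
  forall v, is_sep v -> sep_le r v -> sep_le v u -> sep_order u <= sep_order v.

(** The meet of [v] and [u] lies between [r] and [u], so its order is at least that of [u];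
    submodularity passes the gain to the join. *)
Lemma linked_join_order r u v :
  linked r u -> sep_le r u -> is_sep u -> is_sep v -> sep_le r v ->
  sep_order (sep_join v u) <= sep_order v.
Proof.
move=> link le_ru sep_u sep_v le_rv.
have: sep_order u <= sep_order (sep_meet v u).
  apply: link; first exact: is_sep_meet.
    move: le_ru le_rv => /andP[a b] /andP[c d].
    by rewrite /sep_le subsetI a c subUset b d.
  by rewrite /sep_le subsetIr subsetUr.
have := sep_order_submod v u; lia.
Qed.

End SeparationLattice.

(** * Small separations and tangles *)

Section Duality.
Variables (G : sgraph) (w k : nat).
Hypotheses (le_kw : k <= w) (le_wG : w <= #|G|).
Implicit Types (r s u v : sep G) (P tau : {set sep G}).

Let le_kG : k <= #|G| := leq_trans le_kw le_wG.

(* [small P s] says that the side [s.1] has a tree-decomposition into parts of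
   size [< w] and sides already declared small in [P], with [s.1 :&: s.2] inside
   the root part. *)
Inductive small P : sep G -> Prop :=
| small_base s : s \in P -> small P s
| small_node s tau : in_F w k tau -> sep_inv s \in tau ->
    (forall r, r \in tau -> r <> sep_inv s -> small P r) -> small P s.

Definition down_closed P :=
  forall r s, s \in P -> r \in seps_lt G k -> sep_le r s -> r \in P.

(** Gluing the decompositions of both sides along the separator decomposes the whole graph; for
    empty [P] this is a genuine tree-decomposition. *)
Definition decomposable P :=
  exists2 s, s \in seps_lt G k & small P s /\ small P (sep_inv s).

(** Every separation in the decomposition is replaced by its meet with the inverse of [u].
    Linkedness bounds the orders, and leaves stay in [P] because they only move down. *)
Lemma small_shift P r u s :
    P \subset seps_lt G k -> down_closed P -> is_sep u -> sep_le r u ->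
    linked r u -> small P s -> sep_le s (sep_inv r) ->
  small P (sep_meet s (sep_inv u)).
Proof.
move=> subP downP sep_u le_ru link.
have shift_sep s' : s' \in seps_lt G k -> sep_le s' (sep_inv r) ->
    sep_meet s' (sep_inv u) \in seps_lt G k.
  rewrite !inE => /andP[sep_s ord_s] le_sr.
  rewrite is_sep_meet ?is_sep_inv //=.
  apply: leq_ltn_trans ord_s.
  rewrite -sep_order_inv -[leqRHS]sep_order_inv.
  apply: (linked_join_order link) => //; first by rewrite is_sep_inv.
  by rewrite -sep_le_inv sep_invK.
elim=> {s} [s sP|s tau Ftau s_tau sm IH] le_sr.
  apply: small_base; apply: (downP _ _ sP); last by rewrite /sep_le subsetIl subsetUl.
  by apply: shift_sep => //; apply: (subsetP subP).
have [[_ star_tau] /subsetP sub_tau card_tau] := Ftau.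
have s_sep : s \in seps_lt G k by rewrite -seps_lt_inv sub_tau.
pose sh r := sep_meet r (sep_inv u).
have le_child q : q \in tau -> q <> sep_inv s -> sep_le q s.
  by move=> q_tau q_s; have := star_tau _ _ q_tau s_tau q_s; rewrite sep_invK.
have le_child_r q : q \in tau -> q <> sep_inv s -> sep_le q (sep_inv r).
  by move=> q_tau q_s; apply: sep_le_trans le_sr; apply: le_child.
(* The member [sep_inv s] becomes the inverse of the shifted [s]; the other members are shifted
   directly. *)
pose tau' := sep_inv (sh s) |: [set sh q | q in tau :\ sep_inv s].
have sub_tau' : tau' \subset seps_lt G k.
  apply/subsetP => v /setU1P[->|/imsetP[q /setD1P[/eqP q_s q_tau] ->]].
    by rewrite seps_lt_inv shift_sep.
  by rewrite shift_sep ?sub_tau //; apply: le_child_r.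
apply: (@small_node _ _ tau'); first split=> //.
- split=> [v v_tau'|].
    by apply: (sep_inv_neq le_kG); apply: (subsetP sub_tau').
  have le_sh q : q \in tau -> q <> sep_inv s -> sep_le (sh q) (sh s).
    move=> q_tau /(le_child _ q_tau)/andP[a b].
    by rewrite /sep_le /= !(setSI, setSU).
  move=> v1 v2 /setU1P[->|/imsetP[q1 /setD1P[/eqP q1_s q1_tau] ->]]
    /setU1P[->|/imsetP[q2 /setD1P[/eqP q2_s q2_tau] ->]] // neq.
  + by rewrite sep_le_inv le_sh.
  + by rewrite sep_invK le_sh.
  + have /andP[a b] : sep_le q1 (sep_inv q2).
      by apply: star_tau => // q12; rewrite q12 in neq.
    rewrite /sep_le /=; apply/andP; split.
      by apply: subset_trans (subsetIl _ _) (subset_trans a (subsetUl _ _)).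
    by apply: subset_trans (subsetIl _ _) (subset_trans b (subsetUl _ _)).
(* Enlarging [s.2] by [W] gives a separation above [r] with separator exactly [W]. Its join with [u]
   has order at most |W|, and the new part lies in the separator of that join. *)
- set W := \bigcap_(q in tau) q.2 in card_tau.
  apply: leq_ltn_trans card_tau.
  have s_W : s.1 :&: s.2 \subset W.
    apply/bigcapsP => q q_tau; have [->|/eqP q_s] := eqVneq q (sep_inv s).
      exact: subsetIl.
    by have /andP[_] := le_child _ q_tau q_s; apply: subset_trans; apply: subsetIr.
  have W_s : W \subset s.1 by apply: (bigcap_inf (sep_inv s)).
  have /is_sep_addl-/(_ W) sep_sW : is_sep (sep_inv s).
    by move: s_sep; rewrite -seps_lt_inv inE => /andP[].
  have le_rW : sep_le r ((sep_inv s).1 :|: W, (sep_inv s).2).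
    move: le_sr => /andP[/= a b]; rewrite /sep_le /= a andbT.
    by rewrite (subset_trans b) ?subsetUl.
  have := linked_join_order link le_ru sep_u sep_sW le_rW.
  have -> : sep_order ((sep_inv s).1 :|: W, (sep_inv s).2) = #|W|.
    rewrite /sep_order /= setIUl (setIidPl W_s) setIC; congr #|pred_of_set _|.
    exact/setUidPr.
  apply: leq_trans; apply: subset_leq_card.
  apply/subsetP => x /bigcapP x_tau'; rewrite !inE /=.
  have /= := x_tau' _ (setU11 _ _); rewrite inE => /andP[-> ->]; rewrite !andbT.
  have [//|xu1] := boolP (x \in u.1); first by rewrite orbT.
  rewrite orbF; apply/orP; right; apply/bigcapP => q q_tau.
  have [->|q_s] := eqVneq q (sep_inv s).
    by have /= := x_tau' _ (setU11 _ _); rewrite inE => /andP[].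
  have /x_tau' : sh q \in tau' by rewrite setU1r ?imset_f // !inE q_s.
  by rewrite inE (negPf xu1) orbF.
- exact: setU11.
move=> v /setU1P[//|/imsetP[q /setD1P[/eqP q_s q_tau] ->]] _.
by apply: IH => //; apply: le_child_r.
Qed.

(* Re-rooting at the leaf [r]: when [r] is not of the form [(A, V)], it occurs
   at most once as a leaf. *)
Lemma small_reroot P r s : ~~ (r.1 \subset r.2) -> small (r |: P) s ->
  small P s \/ sep_le r s /\ (small P (sep_inv s) -> small P (sep_inv r)).
Proof.
move=> r_big; elim=> {s} [s /setU1P[->|sP]|s tau Ftau s_tau _ IH].
- by right; rewrite sep_le_refl.
- by left; apply: small_base.
have [[_ star_tau] _ _] := Ftau.
have [all_small|] := classic (forall q, q \in tau -> q <> sep_inv s -> small P q).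
  by left; apply: small_node all_small.
move=> not_all; have [q not_q] := not_all_ex_not _ _ not_all.
have [q_tau not_q'] := imply_to_and _ _ not_q.
have [q_s not_small] := imply_to_and _ _ not_q'.
have [//|[le_rq reroot_q]] := IH q q_tau q_s.
have le_qs : sep_le q s by rewrite -[s]sep_invK; apply: star_tau.
right; split=> [|small_s]; first exact: sep_le_trans le_qs.
(* The same star serves as root node for the inverse of [q]. Another member above [r] would put [r]
   below both [q] and its inverse, forcing [r.1] into [r.2]. *)
apply: reroot_q; apply: (small_node Ftau); first by rewrite sep_invK.
move=> v v_tau; rewrite sep_invK => v_q.
have [->//|/eqP v_s] := eqVneq v (sep_inv s).
have [//|[le_rv _]] := IH v v_tau v_s.
have /andP[a _] := sep_le_trans le_rv (star_tau _ _ v_tau q_tau v_q).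
have /andP[_ b] := le_rq.
by case/negP: r_big; apply: subset_trans b.
Qed.

(** If just one of the two decompositions uses the leaf [r], it is re-rooted at [r] with the other
    attached. If both did, [r] would lie below [s] and its inverse, forcing [r.1] into [r.2]. *)
Lemma small_inv_of_decomposable P r : ~~ (r.1 \subset r.2) ->
  decomposable (r |: P) -> decomposable P \/ small P (sep_inv r).
Proof.
move=> r_big [s s_sep [sm1 sm2]].
have [sm1'|[le1 re1]] := small_reroot r_big sm1;
  have [sm2'|[le2 re2]] := small_reroot r_big sm2; auto.
- by left; exists s.
- by right; apply: re2; rewrite sep_invK.
have /andP[a _] := le2; have /andP[_ b] := le1.
by case/negP: r_big; apply: subset_trans b.
Qed.

(** The single part [r.1] is the separator itself, of size less than [k <= w]. *)
Lemma small_of_subset P r :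
  r \in seps_lt G k -> r.1 \subset r.2 -> small P r.
Proof.
move=> r_sep sub; have r_inv := r_sep; rewrite -seps_lt_inv in r_inv.
apply: (@small_node _ _ [set sep_inv r]); rewrite ?set11 //; last by move=> q /set1P.
split; [split=> [q /set1P->|q v /set1P-> /set1P-> //]| |].
- exact: (sep_inv_neq le_kG).
- by rewrite sub1set.
rewrite big_set1 /=; apply: leq_trans le_kw.
by move: r_sep; rewrite inE /sep_order (setIidPl sub) => /andP[].
Qed.

(** This covers the case excluded from re-rooting: a leaf [r] that is small already can be expanded
    over [P]. *)
Lemma decomposable_of_subset P r : r \in seps_lt G k -> r.1 \subset r.2 ->
  decomposable (r |: P) -> decomposable P.
Proof.
move=> r_sep sub [s s_sep [sm1 sm2]].
have drop v : small (r |: P) v -> small P v.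
  elim=> {v} [v /setU1P[->|vP]|v tau Ftau v_tau _ IH].
  - exact: small_of_subset.
  - exact: small_base.
  - exact: small_node IH.
by exists s => //; split; apply: drop.
Qed.

(** * Growing a tangle *)

Lemma exists_minimal_outside P s : s \in seps_lt G k :\: P ->
  exists r, [/\ r \in seps_lt G k :\: P, sep_le r s &
    forall q, q \in seps_lt G k :\: P -> sep_le q r -> q = r].
Proof.
move=> s_out; pose Q := [pred r | (r \in seps_lt G k :\: P) && sep_le r s].
(* This measure increases strictly along the order of separations, so a minimiser is a minimal
   element. *)
pose m (r : sep G) := #|r.1| + #|~: r.2|.
have Qs : Q s by rewrite /= s_out sep_le_refl.
case: (@arg_minnP _ s Q m Qs) => r /andP[r_out le_rs] min_r.
exists r; split=> // q q_out le_qr.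
have := min_r q; rewrite /= q_out (sep_le_trans le_qr le_rs) => /(_ isT) le_m.
case/andP: (le_qr) => sub1 sub2.
have sub2' : ~: q.2 \subset ~: r.2 by rewrite setCS.
have := subset_leq_card sub1; have := subset_leq_card sub2'.
move: le_m; rewrite /m => le_m c2 c1.
have /eqP e1 : q.1 == r.1 by rewrite eqEcard sub1; lia.
have /eqP/setC_inj e2 : ~: q.2 == ~: r.2 by rewrite eqEcard sub2'; lia.
by case: q r e1 e2 {r_out le_rs min_r q_out le_qr le_m sub1 sub2 sub2' c1 c2}
  => [? ?] [? ?] /= -> ->.
Qed.

(** A separation of least order between [r1] and [r2] is linked to both ends, since inversion
    reverses the order and keeps the separator. *)
Lemma exists_linked r1 r2 s : is_sep s -> sep_le r1 s -> sep_le s r2 ->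
  exists u, [/\ is_sep u, sep_order u <= sep_order s, sep_le r1 u, sep_le u r2 &
    linked r1 u /\ linked (sep_inv r2) (sep_inv u)].
Proof.
move=> sep_s le1 le2.
pose Q := [pred u | [&& is_sep u, sep_le r1 u & sep_le u r2]].
have Qs : Q s by rewrite /= sep_s le1 le2.
case: (@arg_minnP _ s Q (@sep_order G) Qs) => u /and3P[sep_u le1u leu2] min_u.
exists u; split=> //; first exact: min_u.
split=> v sep_v lev1 lev2.
  by apply: min_u; rewrite /= sep_v lev1 (sep_le_trans lev2).
rewrite sep_order_inv -[leqRHS]sep_order_inv; apply: min_u.
rewrite /= is_sep_inv sep_v -sep_le_inv sep_invK -[sep_le _ r2]sep_le_inv.
rewrite sep_invK lev1 andbT.
by apply: sep_le_trans lev2 _; rewrite sep_le_inv.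
Qed.

Lemma down_closedU1 P r : down_closed P -> r \in seps_lt G k :\: P ->
  (forall q, q \in seps_lt G k :\: P -> sep_le q r -> q = r) ->
  down_closed (r |: P).
Proof.
move=> downP r_out min_r q s /setU1P[->|sP] q_sep le_qs; last first.
  by rewrite setU1r //; apply: downP le_qs.
have [qP|q_out] := boolP (q \in P); first by rewrite setU1r.
by rewrite (min_r q) ?setU11 // !inE q_out /=; rewrite inE in q_sep.
Qed.

(** Shifting the decompositions of the inverses of [r1] and [r2] to a linked [u] between [r1] and
    the inverse of [r2] yields exactly the inverse of [u] and [u]. *)
Lemma decomposable_glue P r1 r2 s :
    P \subset seps_lt G k -> down_closed P -> s \in seps_lt G k ->
    sep_le r1 s -> sep_le r2 (sep_inv s) ->
    small P (sep_inv r1) -> small P (sep_inv r2) ->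
  decomposable P.
Proof.
move=> subP downP s_sep le1 le2 sm1 sm2.
have [sep_s ord_s] : is_sep s /\ sep_order s < k by apply/andP; rewrite inE in s_sep.
have le2' : sep_le s (sep_inv r2) by rewrite -sep_le_inv sep_invK.
have [u [sep_u ord_u le1u leu2 [link1 link2]]] := exists_linked sep_s le1 le2'.
rewrite sep_invK in link2.
exists u; first by rewrite inE sep_u (leq_ltn_trans ord_u).
have le2u : sep_le r2 (sep_inv u) by rewrite -sep_le_inv sep_invK.
split.
  have := small_shift subP downP _ le2u link2 sm2 (sep_le_refl _).
  rewrite is_sep_inv => /(_ sep_u); congr small.
  case/andP: leu2 => /= a b.
  by rewrite /sep_meet /= (setIidPr a) (setUidPr b) -surjective_pairing.
have := small_shift subP downP sep_u le1u link1 sm1 (sep_le_refl _).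
congr small; case/andP: le1u => /= a b.
by rewrite /sep_meet /= (setIidPr b) (setUidPr a).
Qed.

(** For any member [s], the star is a node showing that the inverse of [s] is small. A member exists
    because the empty star has intersection V and [w <= #|G|]. *)
Lemma decomposable_of_star P tau :
  P \subset seps_lt G k -> in_F w k tau -> tau \subset P -> decomposable P.
Proof.
move=> subP Ftau /subsetP sub; have [_ /subsetP tau_sep card_tau] := Ftau.
have [tau0|[s s_tau]] := set_0Vmem tau.
  by move: card_tau; rewrite tau0 big_set0 cardsT ltnNge le_wG.
exists s; first exact: tau_sep.
split; first by apply: small_base; apply: sub.
apply: (small_node Ftau); first by rewrite sep_invK.
by move=> q q_tau _; apply: small_base; apply: sub.
Qed.

(** Containing a separation and its inverse, or a star of the forbidden family, would make [P]
    decomposable; consistency then follows from down-closure. *)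
Lemma tangle_of_total P : P \subset seps_lt G k -> down_closed P ->
    ~ decomposable P ->
    (forall s, s \in seps_lt G k -> (s \in P) || (sep_inv s \in P)) ->
  F_tangle w k P.
Proof.
move=> subP downP not_dec total.
have anti s : s \in P -> sep_inv s \in P -> False.
  move=> sP siP; case: not_dec; exists s; first exact: (subsetP subP).
  by split; apply: small_base.
split.
- split=> // s s_sep; apply/eqP/cards1P.
  have := total s s_sep; case sP: (s \in P); case siP: (sep_inv s \in P) => //= _.
  + by case: (anti s).
  + exists s; apply/setP => q; rewrite !inE.
    have [->|_] := eqVneq q s; first by rewrite sP.
    by have [->|_] := eqVneq q (sep_inv s); rewrite ?siP // andbF.
  + exists (sep_inv s); apply/setP => q; rewrite !inE.
    have [->|_] := eqVneq q (sep_inv s); first by rewrite siP orbT.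
    by have [->|_] := eqVneq q s; rewrite ?sP // andbF.
- move=> [r [s [[r_sep s_sep] _ /andP[le_rs _] riP sP]]].
  by apply: (anti r) => //; apply: downP le_rs.
by move=> [tau [sub Ftau]]; apply: not_dec; apply: (decomposable_of_star subP Ftau sub).
Qed.

(** Induction on the number of separations of order less than [k] outside [P]. *)
Lemma tangle_or_decomposable P : P \subset seps_lt G k -> down_closed P ->
  (exists O : {set sep G}, F_tangle w k O) \/ decomposable P.
Proof.
have [n] := ubnP #|seps_lt G k :\: P|; elim: n P => // n IH P lt_n subP downP.
have [dec|not_dec] := classic (decomposable P); first by right.
have [/forall_inP total|] :=
  boolP [forall s in seps_lt G k, (s \in P) || (sep_inv s \in P)].
  by left; exists P; apply: tangle_of_total.
case/forall_inPn => s s_sep; rewrite negb_or => /andP[sP siP].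
left; apply: NNPP => no_tangle.
(* A minimal [r] below [q] may be added to [P]. As no tangle exists, the induction hypothesis makes
   the enlarged set decomposable, and [r] can be eliminated from that decomposition. *)
have forced q : q \in seps_lt G k :\: P -> exists2 r, sep_le r q & small P (sep_inv r).
  move=> /exists_minimal_outside[r [r_out le_rq min_r]]; exists r => //.
  have [r_sep rP] : r \in seps_lt G k /\ r \notin P by case/setDP: r_out.
  have [||//|dec] := IH (r |: P) _ _ (down_closedU1 downP r_out min_r).
  - rewrite -ltnS; apply: leq_trans lt_n; rewrite ltnS; apply: proper_card.
    apply/properP; split; first by rewrite setDS ?subsetUr.
    by exists r => //; rewrite !inE eqxx.
  - by rewrite subUset sub1set r_sep.
  have [sub|big] := boolP (r.1 \subset r.2).
    by case: not_dec; apply: decomposable_of_subset dec.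
  by have [|] := small_inv_of_decomposable big dec.
have [|r1 le1 sm1] := forced s; first by rewrite inE sP.
have [|r2 le2 sm2] := forced (sep_inv s); first by rewrite inE siP seps_lt_inv.
by apply: not_dec; apply: (decomposable_glue subP downP s_sep le1 le2).
Qed.

End Duality.

(** * Bridges and branches in trees *)

Lemma connect_ind (T : finType) (e : rel T) (Q : T -> Prop) (x : T) :
    Q x -> (forall a b, connect e x a -> Q a -> e a b -> Q b) ->
  forall y, connect e x y -> Q y.
Proof.
move=> Qx Qstep _ /connectP[p e_p ->].
elim/last_ind: p e_p => //= p b IH; rewrite rcons_path last_rcons => /andP[e_p e_b].
by apply: Qstep e_b; [apply/connectP; exists p | apply: IH].
Qed.

Lemma uniq_last_head (T : eqType) (a : T) p : uniq (a :: p) -> last a p = a -> p = [::].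
Proof. by case: p => //= b p /andP[a_notin _] eq_a; rewrite -eq_a mem_last in a_notin. Qed.

Section Bridges.
Variable T : sgraph.
Implicit Types (S : pred T) (x y a b : T) (p c : seq T).

(** An edge cut with side [S] that contains at most the one edge from [x] to [y]. *)
Definition bridge S x y :=
  forall a b, edge a b -> S a -> ~~ S b -> a = x /\ b = y.

Lemma bridgeC S x y : bridge S x y -> bridge (predC S) y x.
Proof.
move=> br a b; rewrite edge_sym /= negbK => e_ba nSa Sb.
by have [] := br _ _ e_ba Sb nSa.
Qed.

Lemma path_avoid_bridge S x y a p : bridge S x y ->
  path (@edge T) a p -> ~~ S a -> x \notin p -> all (predC S) p.
Proof.
move=> br; elim: p a => //= b p IH a /andP[e_ab e_p] nSa.
rewrite inE negb_or => /andP[x_b x_p].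
suff nSb : ~~ S b by rewrite nSb (IH b).
apply/negP => Sb; rewrite edge_sym in e_ab.
by have [bx _] := br _ _ e_ab Sb nSa; rewrite bx eqxx in x_b.
Qed.

(** After leaving [S] through [x], a path could return only by visiting [x] again, so it crosses at
    most once. *)
Lemma uniq_path_bridge S x y a p : bridge S x y ->
    path (@edge T) a p -> uniq (a :: p) -> S a ->
  all S p \/
  exists q1 q2, [/\ p = q1 ++ y :: q2, last a q1 = x, all S q1 & all (predC S) (y :: q2)].
Proof.
move=> br; elim: p a => [|b p IH] a; first by left.
rewrite [path _ _ _]/= => /andP[e_ab e_p] uniq_abp Sa.
have [Sb|nSb] := boolP (S b).
  have [|Sp|[q1 [q2 [-> last_q1 Sq1 Sq2]]]] := IH b e_p _ Sb.
  - by move: uniq_abp => /= /andP[].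
  - by left; rewrite /= Sb Sp.
  - by right; exists (b :: q1), q2; split=> //=; rewrite Sb.
have [ax b_y] := br _ _ e_ab Sa nSb; right; exists [::], p.
split=> //=; first by rewrite b_y.
rewrite -b_y nSb; apply: (path_avoid_bridge br e_p nSb).
by move: uniq_abp; rewrite ax /= inE negb_or => /andP[/andP[_ ->]].
Qed.

(** Rotated to start in [S], a cycle that leaves [S] must close up along the same edge, so it
    consists of [x] and [y] alone. *)
Lemma ucycle_bridge S x y c : bridge S x y ->
  ucycle (@edge T) c -> 2 < size c -> has S c -> all S c.
Proof.
move=> br uc size_c /hasP[z /rot_to[i q rot_c] Sz].
move: uc size_c; rewrite -(rot_ucycle i) -(size_rot i) -(eq_all_r (mem_rot i c)) rot_c.
rewrite /ucycle [cycle _ _]/= rcons_path => /andP[/andP[e_q e_z] uniq_q] size_q.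
have [Sq|[q1 [q2 [def_q last_q1 Sq1 /allP nSq2]]]] := uniq_path_bridge br e_q uniq_q Sz.
  by rewrite /= Sz.
have last_q : last z q = last y q2 by rewrite def_q last_cat.
have [zx lasty] : z = x /\ last y q2 = y.
  rewrite -last_q; apply: br => //; first by rewrite edge_sym.
  by rewrite last_q; apply: nSq2; apply: mem_last.
move: uniq_q size_q; rewrite def_q -cat_cons cat_uniq => /and3P[uniq_q1 _ uniq_q2].
rewrite (uniq_last_head uniq_q2 lasty) (@uniq_last_head _ z q1) //.
by rewrite last_q1 zx.
Qed.

End Bridges.

Section Branches.
Variable T : sgraph.
Hypothesis treeT : is_tree T.
Implicit Types (x y a b t : T).

Let conT : connected_graph T. Proof. by case: treeT. Qed.
Let acyT : acyclic_graph T. Proof. by case: treeT. Qed.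

Lemma edge_neq x y : edge x y -> x != y.
Proof. by apply: contraTneq => ->; rewrite edge_irrefl. Qed.

Lemma uniq_path_exists x y :
  exists p, [/\ path (@edge T) x p, uniq (x :: p) & last x p = y].
Proof.
have /connectP[p e_p ->] := conT x y.
by have [q e_q uniq_q _] := shortenP e_p; exists q.
Qed.

(** For an edge [x y] of a tree, the component of [x] after deleting that edge; walks are only
    forbidden to step into [y]. *)
Definition branch x y : pred T := connect [rel a b | edge a b && (b != y)] x.

Lemma branch_root x y : branch x y x.
Proof. exact: connect0. Qed.

Lemma branch_avoid x y : x != y -> ~~ branch x y y.
Proof.
move=> x_y; apply/negP => /connectP[p]; case/lastP: p => [|p z].
  by move=> _ /= y_x; rewrite y_x eqxx in x_y.
by rewrite rcons_path last_rcons => /andP[_ /= /andP[_ z_y]] y_z; rewrite y_z eqxx in z_y.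
Qed.

Lemma branch_step x y a b : branch x y a -> edge a b -> b != y -> branch x y b.
Proof.
by move=> xa e_ab b_y; apply: connect_trans xa _; apply: connect1; rewrite /= e_ab.
Qed.

Lemma branch_bridge x y : edge x y -> bridge (branch x y) x y.
Proof.
move=> e_xy a b e_ab br_a nbr_b.
have b_y : b = y by apply/eqP; apply: contraNT nbr_b; apply: branch_step e_ab.
split=> //; move: br_a e_ab => /connectP[p0 e_p0 ->{a}].
have [p e_p uniq_p _] := shortenP e_p0; rewrite b_y => e_y.
case: p e_p uniq_p e_y => // z p e_p uniq_p e_y; exfalso.
(* A second neighbour of [y] in the branch closes a cycle through [y] with the path from [x]. *)
apply: (acyT (c := [:: y, x, z & p])) => //.
rewrite /ucycle [cycle _ _]/= edge_sym e_xy.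
have sub : subrel [rel a b | edge a b && (b != y)] (@edge T) by move=> ? ? /andP[].
have /= /andP[-> e_p'] := sub_path sub e_p; rewrite rcons_path e_p' /=.
rewrite [edge _ y]e_y; move: uniq_p => /= ->; rewrite andbT.
rewrite inE negb_or eq_sym edge_neq //=.
apply/negP => y_p; have /path_connect/(_ y) := e_p; rewrite inE y_p orbT => /(_ isT).
by apply/negP/branch_avoid/edge_neq.
Qed.

(** The bridge property makes the two branches disjoint; connectedness makes them cover the tree. *)
Lemma branchC x y t : edge x y -> branch y x t = ~~ branch x y t.
Proof.
move=> e_xy; have e_yx : edge y x by rewrite edge_sym.
apply/idP/idP => [|].
  apply: (connect_ind (Q := fun t => ~~ branch x y t)) => [|a b _ nbr_a /andP[e_ab b_x]].
    exact/branch_avoid/edge_neq.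
  apply/negP => br_b; rewrite edge_sym in e_ab.
  by have [bx _] := branch_bridge e_xy e_ab br_b nbr_a; rewrite bx eqxx in b_x.
suff : branch x y t || branch y x t by case: (branch x y t).
apply: (connect_ind (Q := fun t => branch x y t || branch y x t)) (conT x t).
  by rewrite branch_root.
move=> a b _ /orP[] br_a e_ab.
  have [->|b_y] := eqVneq b y; first by rewrite branch_root orbT.
  by rewrite (branch_step br_a e_ab).
have [->|b_x] := eqVneq b x; first by rewrite branch_root.
by rewrite (branch_step br_a e_ab) ?orbT.
Qed.

(** The branches at [t] through distinct neighbours are disjoint: reaching [y] would give a second
    edge back to [t]. This yields the star property. *)
Lemma branch_sub x y t a : edge x t -> edge y t -> x != y ->
  branch x t a -> branch t y a.
Proof.
move=> e_xt e_yt x_y; have e_tx : edge t x by rewrite edge_sym.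
apply: (connect_ind (Q := branch t y)) => [|b c br_b br_b' /andP[e_bc c_t]].
  exact: branch_step (branch_root _ _) e_tx x_y.
apply: (branch_step br_b' e_bc); apply/eqP => c_y.
have br_c : branch x t c by apply: branch_step br_b e_bc c_t.
rewrite c_y in br_c.
have [yx _] := branch_bridge e_xt e_yt br_c (branch_avoid (edge_neq e_xt)).
by rewrite yx eqxx in x_y.
Qed.

(* The orbits of [f] are cycles of [T], except for fixed points and 2-cycles. *)
Lemma tree_step_returns (f : T -> T) :
  (forall t, edge t (f t)) -> exists t, f (f t) = t.
Proof.
move=> e_f; have [/card_gt0P[x _] _ _] := treeT.
(* The iterates of [f] from [x] eventually repeat; [y] is a point to which they return. *)
have /trajectP[i lt_i iter_i] := looping_order f x.
pose y := iter i f x.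
have /(orbitPcycle 3 0) cyc : exists n, iter n.+1 f y = y.
  exists (order f x - i).-1.
  by rewrite prednK ?subn_gt0 // -iterD subnK // ltnW.
have iter_y := (orbitPcycle 0 4).1 cyc.
have [lt2|] := ltnP 2 (order f y).
  case: (acyT (c := orbit f y)); rewrite ?size_orbit //.
  rewrite /ucycle orbit_uniq andbT.
  by apply: sub_cycle cyc => a b /eqP <-.
move=> le2; exists y; move: iter_y (order_gt0 f y) le2.
by case: (order f y) => [|[|[|]]] //= fy; rewrite ?fy.
Qed.

End Branches.

(** * From tree-decompositions to S_k-trees *)

Section TreeDecompositionToSTree.
Variables (G : sgraph) (w k : nat) (T : sgraph) (bag : T -> {set G}).
Hypotheses (le_kw : k <= w) (le_wG : w <= #|G|) (td : tree_decomposition bag)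
  (card_bag : forall t, #|bag t| < w)
  (card_adh : forall s t, edge s t -> #|bag s :&: bag t| < k).

Let treeT : is_tree T. Proof. by case: td. Qed.

Definition side (x y : T) : {set G} := \bigcup_(t | branch x y t) bag t.

Definition side_sep x y : sep G := (side x y, side y x).

(** A path between bags on the two sides that share a vertex runs through [x] and [y], so
    interpolation applies. *)
Lemma side_cap x y : edge x y -> side x y :&: side y x \subset bag x :&: bag y.
Proof.
move=> e_xy; apply/subsetP => v; rewrite inE.
move=> /andP[/bigcupP[t br_t v_t] /bigcupP[t' br_t' v_t']].
rewrite branchC // in br_t'.
have [p [e_p uniq_p last_p]] := uniq_path_exists treeT t t'.
have [Sp|[q1 [q2 [def_p last_q1 _ _]]]] :=
  uniq_path_bridge (branch_bridge treeT e_xy) e_p uniq_p br_t.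
  have : all (branch x y) (t :: p) by rewrite /= br_t.
  by move=> /allP/(_ t'); rewrite -last_p mem_last last_p (negPf br_t') => /(_ isT).
have [_ _ _ interp] := td.
have v_p z : z \in t :: p -> v \in bag z.
  move=> z_p; have /subsetP := interp t z t' p e_p last_p uniq_p z_p.
  by apply; rewrite inE v_t.
rewrite inE !v_p // def_p -cat_cons mem_cat ?mem_head ?orbT //.
by rewrite -last_q1 mem_last.
Qed.

Lemma side_sep_in x y : edge x y -> side_sep x y \in seps_lt G k.
Proof.
move=> e_xy; have [_ cov cov_edge _] := td.
rewrite inE; apply/andP; split; last first.
  by apply: leq_ltn_trans (card_adh e_xy); apply/subset_leq_card/side_cap.
have in_side v t : v \in bag t ->
      (branch x y t -> v \in side x y) /\ (~~ branch x y t -> v \in side y x).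
  by move=> v_t; split=> br_t; apply/bigcupP; exists t; rewrite ?(branchC treeT t e_xy).
apply/is_sepP; split=> [v|u v e_uv] /=.
  have /bigcupP[t _ /in_side[s1 s2]] : v \in \bigcup_(t : T) bag t by rewrite cov inE.
  by case br_t: (branch x y t) s1 s2 => s1 s2; [rewrite s1 | rewrite s2 ?orbT].
have [t [/in_side[u1 u2] /in_side[v1 v2]]] := cov_edge _ _ e_uv.
case br_t: (branch x y t) u1 u2 v1 v2 => u1 u2 v1 v2.
  by rewrite u1 ?v1.
by rewrite u2 ?v2 ?orbT.
Qed.

Lemma S_tree_of_td : S_tree_over_F w k side_sep.
Proof.
have [_ cov _ _] := td.
split=> // [x y e_xy|t]; first by rewrite side_sep_in.
have sub : [set side_sep x t | x : T & edge x t] \subset seps_lt G k.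
  apply/subsetP => _ /imsetP[x e_xt ->]; rewrite inE in e_xt; exact: side_sep_in.
split=> //; first split=> [s /(subsetP sub)|].
- exact: (sep_inv_neq (leq_trans le_kw le_wG)).
- move=> _ _ /imsetP[x /[!inE] e_xt ->] /imsetP[y /[!inE] e_yt ->] neq.
  have x_y : x != y by apply: contra_notN neq => /eqP ->.
  have side_sub a b : edge a t -> edge b t -> a != b -> side a t \subset side t b.
    move=> e_a e_b a_b; apply/bigcupsP => z br_z.
    by apply: bigcup_sup; apply: branch_sub br_z.
  by rewrite /sep_le /= !side_sub // eq_sym.
(* The intersection lies in the bag of [t]: if [v] occurs in a bag beyond a neighbour [x], it lies
   on both sides of that edge, hence in both end bags. *)
apply: leq_ltn_trans (card_bag t); apply/subset_leq_card/subsetP => v /bigcapP v_in.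
have /bigcupP[t' _ v_t'] : v \in \bigcup_(t : T) bag t by rewrite cov inE.
have [p [e_p uniq_p last_p]] := uniq_path_exists treeT t t'.
case: p e_p uniq_p last_p => [|x p] /=; first by move=> _ _ ->.
move=> /andP[e_tx e_p] /andP[t_p _] last_p; rewrite edge_sym in e_tx.
have br_t' : branch x t t'.
  apply/connectP; exists p => //; move: t_p e_p; rewrite inE negb_or => /andP[_].
  elim: p (x) {last_p e_tx} => //= b p IH a.
  rewrite inE negb_or eq_sym => /andP[-> t_p] /andP[-> /=].
  exact: IH.
have : v \in bag x :&: bag t.
  apply: (subsetP (side_cap e_tx)); rewrite inE; apply/andP; split.
    by apply/bigcupP; exists t'.
  by apply: (v_in (side_sep x t)); apply: imset_f; rewrite inE.
by rewrite inE => /andP[].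
Qed.

End TreeDecompositionToSTree.

(** * From small separations to tree-decompositions *)

Section Interpolation.
Variables (G T : sgraph) (bag : T -> {set G}).
Implicit Types (S : pred T) (x y : T) (p : seq T).

(** The interpolation condition restricted to paths inside [S], so that the two sides of a bridge
    can be treated separately. *)
Definition interpolates_on S := forall x t p,
  path (@edge T) x p -> uniq (x :: p) -> all S (x :: p) -> t \in x :: p ->
  bag x :&: bag (last x p) \subset bag t.

(** A vertex shared by bags across the bridge lies in the bags of [x] and [y], which reduces the
    claim to the two halves of the path. *)
Lemma interpolates_bridge S x y : bridge S x y ->
    interpolates_on S -> interpolates_on (predC S) ->
    (forall a b, S a -> ~~ S b -> bag a :&: bag b \subset bag x :&: bag y) ->
  forall a t p, S a -> path (@edge T) a p -> uniq (a :: p) -> t \in a :: p ->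
  bag a :&: bag (last a p) \subset bag t.
Proof.
move=> br int1 int2 cap a t p Sa e_p uniq_p t_p.
have [Sp|[q1 [q2 [def_p last_q1 Sq1 Sq2]]]] := uniq_path_bridge br e_p uniq_p Sa.
  by apply: int1; rewrite //= Sa.
have [e_q1 e_q2] : path (@edge T) a q1 /\ path (@edge T) y q2.
  by apply/andP; move: e_p; rewrite def_p cat_path /= => /and3P[-> _ ->].
have [uniq_q1 uniq_q2] : uniq (a :: q1) /\ uniq (y :: q2).
  by apply/andP; move: uniq_p; rewrite def_p -cat_cons cat_uniq => /and3P[-> _ ->].
move: t_p; rewrite def_p last_cat -cat_cons mem_cat [last _ _]/= => t_p.
have Sz : ~~ S (last y q2) by apply: (allP Sq2); apply: mem_last.
apply/subsetP => v; rewrite inE => /andP[v_a v_z].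
have : v \in bag x :&: bag y by apply: (subsetP (cap _ _ Sa Sz)); rewrite inE v_a.
rewrite inE => /andP[v_x v_y]; case/orP: t_p => t_q.
  have Saq1 : all S (a :: q1) by rewrite /= Sa.
  have /subsetP/(_ v) := int1 a t q1 e_q1 uniq_q1 Saq1 t_q.
  by rewrite last_q1 inE v_a v_x => ->.
have /subsetP/(_ v) := int2 y t q2 e_q2 uniq_q2 Sq2 t_q.
by rewrite inE v_y v_z => ->.
Qed.

End Interpolation.

(** * Joining two trees by an edge *)

Section JoinTrees.
Variables (T1 T2 : sgraph) (t1 : T1) (t2 : T2).

Definition join_edge : rel (T1 + T2)%type := fun a b =>
  match a, b with
  | inl a, inl b => edge a b
  | inr a, inr b => edge a b
  | inl a, inr b => (a == t1) && (b == t2)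
  | inr b, inl a => (a == t1) && (b == t2)
  end.

Lemma join_edge_sym : symmetric join_edge.
Proof. by move=> [a|a] [b|b] //=; apply: edge_sym. Qed.

Lemma join_edge_irrefl : irreflexive join_edge.
Proof. by move=> [a|a] /=; apply: edge_irrefl. Qed.

Definition join_graph : sgraph := SGraph join_edge_sym join_edge_irrefl.

Definition in_left : pred join_graph := fun a => if a is inl _ then true else false.

Lemma join_bridge : @bridge join_graph in_left (inl t1) (inr t2).
Proof. by move=> [a|a] [b|b] //= /andP[/eqP-> /eqP->]. Qed.

Lemma all_in_left (p : seq join_graph) : all in_left p -> exists q, p = map inl q.
Proof.
elim: p => [|[a|a] p IH] //=; first by exists [::].
by move=> /IH[q ->]; exists (a :: q).
Qed.

Lemma all_in_right (p : seq join_graph) : all (predC in_left) p -> exists q, p = map inr q.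
Proof.
elim: p => [|[a|a] p IH] //=; first by exists [::].
by move=> /IH[q ->]; exists (a :: q).
Qed.

Lemma inl_inj : injective (@inl T1 T2). Proof. by move=> a b []. Qed.
Lemma inr_inj : injective (@inr T1 T2). Proof. by move=> a b []. Qed.

(** The new edge is a bridge, so every cycle stays in one of the two trees. *)
Lemma join_is_tree : is_tree T1 -> is_tree T2 -> is_tree join_graph.
Proof.
move=> [T1_gt0 con1 acy1] [_ con2 acy2]; split.
- by rewrite card_sum addn_gt0 T1_gt0.
- have inl_con a b : connect join_edge (inl a) (inl b).
    pose Q b := connect join_edge (inl a) (inl b).
    apply: (connect_ind (Q := Q)) (con1 a b) => [|c d _ ac cd].
      exact: connect0.
    exact: connect_trans ac (connect1 _).
  have inr_con a b : connect join_edge (inr a) (inr b).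
    pose Q b := connect join_edge (inr a) (inr b).
    apply: (connect_ind (Q := Q)) (con2 a b) => [|c d _ ac cd].
      exact: connect0.
    exact: connect_trans ac (connect1 _).
  have across a b : connect join_edge (inl a) (inr b).
    apply: connect_trans (inl_con a t1) _; apply: connect_trans (inr_con t2 b).
    by apply: connect1; rewrite /= !eqxx.
  move=> [a|a] [b|b] //=.
  by rewrite (sym_connect_sym join_edge_sym).
move=> c size_c uc; have [has_l|] := boolP (has in_left c).
  have /all_in_left[q def_c] := ucycle_bridge join_bridge uc size_c has_l.
  move: uc size_c; rewrite {}def_c size_map => /andP[cyc_q].
  rewrite (map_inj_uniq inl_inj) => uniq_q size_q; apply: (acy1 q) => //.
  by rewrite /ucycle uniq_q andbT; rewrite cycle_map in cyc_q.
rewrite -all_predC => /all_in_right[q def_c].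
move: uc size_c; rewrite {}def_c size_map => /andP[cyc_q].
rewrite (map_inj_uniq inr_inj) => uniq_q size_q; apply: (acy2 q) => //.
by rewrite /ucycle uniq_q andbT; rewrite cycle_map in cyc_q.
Qed.

Variables (G : sgraph) (bag1 : T1 -> {set G}) (bag2 : T2 -> {set G}).

Definition join_bag (a : join_graph) : {set G} :=
  match a with inl a => bag1 a | inr a => bag2 a end.

Lemma join_interpolates :
    interpolates_on bag1 predT -> interpolates_on bag2 predT ->
    (forall a b, bag1 a :&: bag2 b \subset bag1 t1 :&: bag2 t2) ->
  interpolates_on join_bag predT.
Proof.
move=> int1 int2 cap.
have int_l : interpolates_on join_bag in_left.
  move=> [a|//] t p e_p uniq_p /= /all_in_left[q def_p]; move: e_p uniq_p; rewrite {}def_p.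
  rewrite -[inl a :: _]/(map inl (a :: q)) path_map (map_inj_uniq inl_inj).
  move=> e_q uniq_q /mapP[b b_q ->]; rewrite last_map /=.
  by apply: int1 => //; apply/allP.
have int_r : interpolates_on join_bag (predC in_left).
  move=> [//|a] t p e_p uniq_p /= /all_in_right[q def_p]; move: e_p uniq_p; rewrite {}def_p.
  rewrite -[inr a :: _]/(map inr (a :: q)) path_map (map_inj_uniq inr_inj).
  move=> e_q uniq_q /mapP[b b_q ->]; rewrite last_map /=.
  by apply: int2 => //; apply/allP.
move=> a t p e_p uniq_p _; have [left_a|right_a] := boolP (in_left a).
  apply: (interpolates_bridge join_bridge int_l int_r _ left_a) => //.
  by move=> [x|x] [y|y] //= _ _; apply: cap.
apply: (interpolates_bridge (bridgeC join_bridge) int_r _ _ right_a) => //.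
  by move=> x y q e_q uniq_q in_q; apply: int_l => //; apply: sub_all in_q => z /= /negPn.
by move=> [x|x] [y|y] //= _ _; rewrite setIC (setIC (bag2 t2)); apply: cap.
Qed.

End JoinTrees.

(** * Rooted decompositions of vertex sets *)

Section RootedDecompositions.
Variables (G : sgraph) (w k : nat).
Implicit Types (A X : {set G}).

(** A decomposition of the subgraph induced on [A], with the bounds on parts and adhesion built
    in. *)
Definition decomposes (T : sgraph) (bag : T -> {set G}) A :=
  [/\ \bigcup_(t : T) bag t = A,
      forall u v : G, u \in A -> v \in A -> edge u v ->
        exists t, u \in bag t /\ v \in bag t,
      interpolates_on bag predT,
      forall t, #|bag t| < w &
      forall s t : T, edge s t -> #|bag s :&: bag t| < k].

Definition rooted_td A X := exists (T : sgraph) (bag : T -> {set G}) (t : T),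
  [/\ is_tree T, decomposes bag A & bag t = X].

Lemma unit_edge_sym : symmetric (fun _ _ : unit => false). Proof. by []. Qed.
Lemma unit_edge_irrefl : irreflexive (fun _ _ : unit => false). Proof. by []. Qed.
Definition unit_graph : sgraph := SGraph unit_edge_sym unit_edge_irrefl.

Lemma unit_graph_tree : is_tree unit_graph.
Proof.
split; first by rewrite card_unit.
  by move=> [] []; apply: connect0.
by move=> [|x [|y c]] //= _; rewrite /ucycle /= andbF.
Qed.

Lemma rooted_td_leaf X : #|X| < w -> rooted_td X X.
Proof.
move=> card_X; exists unit_graph, (fun=> X), tt; split=> //; first exact: unit_graph_tree.
split=> //.
- by apply/setP => v; apply/bigcupP/idP => [[]//|v_X]; exists tt.
- by move=> x t p _ _ _ _; rewrite setIid.
Qed.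

(** The roots are joined by an edge of adhesion |X1 :&: X2|. The root [X1] is kept, so that several
    decompositions can be attached to it in turn. *)
Lemma rooted_td_join A1 X1 A2 X2 :
    rooted_td A1 X1 -> rooted_td A2 X2 -> A1 :&: A2 \subset X1 :&: X2 ->
    #|X1 :&: X2| < k ->
    (forall u v, u \in A1 -> u \notin A2 -> v \in A2 -> v \notin A1 -> ~~ edge u v) ->
  rooted_td (A1 :|: A2) X1.
Proof.
move=> [T1 [bag1 [t1 [tree1 [cov1 edge1 int1 card1 adh1] def_X1]]]].
move=> [T2 [bag2 [t2 [tree2 [cov2 edge2 int2 card2 adh2] def_X2]]]].
move=> cap card_cap no_edge.
exists (join_graph t1 t2), (join_bag bag1 bag2), (inl t1).
split=> //; first exact: join_is_tree.
have bag1_sub a : bag1 a \subset A1 by rewrite -cov1 (bigcup_sup a).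
have bag2_sub a : bag2 a \subset A2 by rewrite -cov2 (bigcup_sup a).
split.
- apply/setP => v; rewrite inE -cov1 -cov2; apply/bigcupP/orP.
    by move=> [[a|a] _ /= v_a]; [left|right]; apply/bigcupP; exists a.
  by move=> [/bigcupP[a _ v_a]|/bigcupP[a _ v_a]]; [exists (inl a) | exists (inr a)].
- have in1 u v : u \in A1 -> v \in A1 -> edge u v ->
      exists t, u \in join_bag bag1 bag2 t /\ v \in @join_bag _ _ t1 t2 _ bag1 bag2 t.
    by move=> u1 v1 /(edge1 _ _ u1 v1)[t ?]; exists (inl t).
  have in2 u v : u \in A2 -> v \in A2 -> edge u v ->
      exists t, u \in join_bag bag1 bag2 t /\ v \in @join_bag _ _ t1 t2 _ bag1 bag2 t.
    by move=> u1 v1 /(edge2 _ _ u1 v1)[t ?]; exists (inr t).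
  move=> u v; rewrite !inE.
  case u1: (u \in A1); case u2: (u \in A2) => //;
  case v1: (v \in A1); case v2: (v \in A2) => // _ _ e_uv; auto.
    by case/negP: (no_edge u v u1 (negbT u2) v2 (negbT v1)).
  by case/negP: (no_edge v u v1 (negbT v2) u2 (negbT u1)); rewrite edge_sym.
- apply: join_interpolates => // a b; rewrite def_X1 def_X2.
  by apply: subset_trans cap; apply: setISS.
- by case.
by move=> [a|a] [b|b] /=; auto => /andP[/eqP-> /eqP->]; rewrite ?def_X1 ?def_X2 // setIC.
Qed.

(** Each star gives the root part [W], the intersection of its second sides, to which the
    decompositions of its other members are attached one by one. *)
Lemma rooted_td_of_small (s : sep G) : small w k set0 s ->
  exists X, rooted_td s.1 X /\ s.1 :&: s.2 \subset X.
Proof.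
elim=> {s} [s|s tau [[_ star_tau] /subsetP sub_tau card_tau] s_tau _ IH].
  by rewrite inE.
set W := \bigcap_(r in tau) r.2 in card_tau.
have le_child q : q \in tau -> q <> sep_inv s -> sep_le q s.
  by move=> q_tau q_s; have := star_tau _ _ q_tau s_tau q_s; rewrite sep_invK.
have W_s : W \subset s.1 by apply: (bigcap_inf (sep_inv s)).
exists W; split; last first.
  apply/bigcapsP => q q_tau; have [->|/eqP q_s] := eqVneq q (sep_inv s).
    exact: subsetIl.
  by have /andP[_] := le_child _ q_tau q_s; apply: subset_trans; apply: subsetIr.
pose ch := enum (tau :\ sep_inv s).
(* A vertex of [s.1] outside [W] misses some [q.2], hence lies in [q.1]; this [q] is not
   [sep_inv s], whose second side is [s.1]. *)
have -> : s.1 = W :|: \bigcup_(r <- ch) r.1.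
  apply/eqP; rewrite eqEsubset subUset W_s big_enum /=; apply/andP; split; last first.
    apply/bigcupsP => q /setD1P[/eqP q_s q_tau].
    by have /andP[] := le_child _ q_tau q_s.
  apply/subsetP => v v_s; rewrite inE.
  have [//|/bigcapP not_W /=] := boolP (v \in W).
  have [q q_tau v_q] : exists2 q, q \in tau & v \notin q.2.
    apply/exists_inP; apply: contra_notT not_W.
    rewrite negb_exists_in => /forall_inP all_q q q_tau.
    by have := all_q q q_tau; rewrite negbK.
  apply/bigcupP; exists q.
    by rewrite !inE q_tau andbT; apply: contraNneq v_q => ->.
  have := sub_tau _ q_tau; rewrite inE => /andP[/is_sepP[/(_ v)]].
  by rewrite (negPf v_q) orbF.
have {IH} IH r : r \in ch -> exists X, rooted_td r.1 X /\ r.1 :&: r.2 \subset X.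
  by rewrite mem_enum => /setD1P[/eqP r_s r_tau]; apply: IH.
have ch_tau r : r \in ch -> r \in tau by rewrite mem_enum => /setD1P[].
have uniq_ch : uniq ch by apply: enum_uniq.
elim: ch uniq_ch IH ch_tau => [|r ch IHch] /=.
  by move=> _ _ _; rewrite big_nil setU0; apply: rooted_td_leaf.
move=> /andP[r_ch uniq_ch] IH ch_tau.
have r_tau : r \in tau by apply: ch_tau; rewrite mem_head.
have [X [td_r cap_X]] := IH r (mem_head _ _).
have r_W : r.1 :&: r.2 \subset W.
  apply/bigcapsP => q q_tau; have [->|/eqP q_r] := eqVneq q r; first exact: subsetIr.
  by have /andP[_] := star_tau _ _ q_tau r_tau q_r; apply: subset_trans; apply: subsetIl.
have W_r : W \subset r.2 by apply: bigcap_inf.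
have /andP[/is_sepP[cov_r edge_r] ord_r] : is_sep r && (sep_order r < k).
  by have := sub_tau _ r_tau; rewrite inE.
have X_r : X \subset r.1.
  have [T [bag [t [_ [<- _ _ _ _] <-]]]] := td_r; exact: (bigcup_sup t).
rewrite big_cons setUCA setUC.
(* By the star property all that is built so far lies in [r.2], so it meets [r.1] only in the
   separator of [r]. *)
have ch_r : W :|: \bigcup_(q <- ch) q.1 \subset r.2.
  rewrite subUset W_r big_seq; apply: (big_ind (fun A : {set G} => A \subset r.2)).
  - exact: sub0set.
  - by move=> A1 A2 s1 s2; rewrite subUset s1.
  move=> q q_ch; have q_r : q <> r by move=> qr; rewrite -qr q_ch in r_ch.
  by have /andP[] := star_tau _ _ (ch_tau _ (mem_behead (s := r :: ch) q_ch)) r_tau q_r.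
apply: (fun td => rooted_td_join td td_r).
- apply: IHch => // q q_ch; [apply: IH | apply: ch_tau]; exact: (mem_behead (s := r :: ch)).
- apply/subsetP => v; rewrite inE => /andP[/(subsetP ch_r) v2 v1].
  have v12 : v \in r.1 :&: r.2 by rewrite inE v1.
  by rewrite inE (subsetP cap_X) // (subsetP r_W).
- apply: leq_ltn_trans ord_r; rewrite /sep_order setIC; apply: subset_leq_card.
  exact: setISS.
move=> u v u_ch u_r v_r v_ch; apply/negP => /edge_r; rewrite (negPf u_r) /=.
move=> /andP[_ v_r2]; case/negP: v_ch; rewrite inE (subsetP r_W) //.
by rewrite inE v_r.
Qed.

(** Both root parts contain the separator and each lies in its own side, so they meet exactly in the
    separator. *)
Lemma rooted_td_of_decomposable : decomposable w k (set0 : {set sep G}) ->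
  exists X, rooted_td [set: G] X.
Proof.
move=> [s s_sep [/rooted_td_of_small[X1 [td1 cap1]] /rooted_td_of_small[X2 [td2 cap2]]]].
move: s_sep; rewrite inE => /andP[/is_sepP[cov edge_s] ord_s].
exists X1; have -> : [set: G] = s.1 :|: (sep_inv s).1 by apply/setP => v; rewrite !inE cov.
have sub A X : rooted_td A X -> X \subset A.
  by move=> [T [bag [t [_ [<- _ _ _ _] <-]]]]; exact: (bigcup_sup t).
apply: (rooted_td_join td1 td2).
- by rewrite subsetI cap1 /= setIC.
- apply: leq_ltn_trans ord_s; apply: subset_leq_card.
  by apply: setISS; [exact: sub td1 | exact: sub td2].
move=> u v u1 u2 v2 v1; apply/negP => /edge_s; rewrite /= in u2 v2 *.
by rewrite (negPf u2) (negPf v1) andbF.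
Qed.

Lemma td_of_rooted_td X : 0 < k -> k <= w -> rooted_td [set: G] X ->
  exists (T : sgraph) (bag : T -> {set G}),
    [/\ tree_decomposition bag, (width bag < w%:Z - 1)%R & adhesion bag < k].
Proof.
move=> k_gt0 le_kw [T [bag [_ [treeT [cov edge_bag int card_bag adh] _]]]].
exists T, bag; split.
- split=> // [u v e_uv|a t b p e_p last_p uniq_p t_p].
    by apply: edge_bag; rewrite ?inE.
  by rewrite -last_p; apply: int => //; apply/allP.
- suff : \max_(t : T) #|bag t| < w by rewrite /width; lia.
  (* The default value 0 of the maximum is below [w] because [0 < k <= w]. *)
  apply: (big_ind (fun n => n < w)) => // [|m n]; first exact: leq_trans le_kw.
  by rewrite gtn_max => -> ->.
apply: (big_ind (fun n => n < k)) => // [m n|p]; first by rewrite gtn_max => -> ->.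
exact: adh.
Qed.

End RootedDecompositions.

(** * Tangles against S_k-trees, and the equivalences *)

(** At each node some incoming separation is outside [O], else its star would be forbidden.
    Following such edges backtracks somewhere, leaving an edge with neither orientation in [O]. *)
Lemma tangle_no_S_tree (G : sgraph) w k (O : {set sep G}) (T : sgraph)
    (alpha : T -> T -> sep G) :
  F_tangle w k O -> ~ S_tree_over_F w k alpha.
Proof.
move=> [[_ orient] _ noF] [treeT alpha_sep alpha_F].
have out t : exists x, edge x t && (alpha x t \notin O).
  apply/existsP; apply: contra_notT (noF) => /existsPn no_out.
  exists [set alpha x t | x : T & edge x t]; split=> //.
  apply/subsetP => _ /imsetP[x /[!inE] e_xt ->].
  by have := no_out x; rewrite e_xt negbK.
pose f t := xchoose (out t).
have e_f t : edge t (f t) by rewrite edge_sym; have /andP[] := xchooseP (out t).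
have [t ft] := tree_step_returns treeT e_f.
have /andP[_ out1] := xchooseP (out t); have /andP[_] := xchooseP (out (f t)).
rewrite -/(f (f t)) ft => out2; rewrite -/(f t) in out1.
have [al_sep al_inv] := alpha_sep _ _ (e_f t).
have /eqP := orient _ al_sep.
suff -> : O :&: [set alpha t (f t); sep_inv (alpha t (f t))] = set0 by rewrite cards0.
apply/setP => s; rewrite !inE -al_inv; apply: contraTF isT.
by case/andP=> s_O /orP[]/eqP def_s; rewrite -def_s s_O in out1 out2.
Qed.

Theorem theorem9p3 (G : sgraph) (w k : nat)
    (G_nonempty : 0 < #|G|) (k_gt0 : 0 < k) (le_kw : k <= w) :
  ((exists O : {set sep G}, F_tangle w k O) <->
   ~ (exists (T : sgraph) (alpha : T -> T -> sep G), S_tree_over_F w k alpha))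
  /\
  (~ (exists (T : sgraph) (alpha : T -> T -> sep G), S_tree_over_F w k alpha) <->
   ~ (exists (T : sgraph) (bag : T -> {set G}),
        [/\ tree_decomposition bag,
            (width bag < w%:Z - 1)%R & adhesion bag < k])).
Proof.
have tangle_no_tree : (exists O : {set sep G}, F_tangle w k O) ->
    ~ (exists (T : sgraph) (alpha : T -> T -> sep G), S_tree_over_F w k alpha).
  by move=> [O tangle] [T [alpha]]; apply: tangle_no_S_tree tangle.
have td_tree : (exists (T : sgraph) (bag : T -> {set G}),
        [/\ tree_decomposition bag,
            (width bag < w%:Z - 1)%R & adhesion bag < k]) ->
    exists (T : sgraph) (alpha : T -> T -> sep G), S_tree_over_F w k alpha.
  move=> [T [bag [td width_bag adh_bag]]].
  have [lt_Gw|le_wG] := ltnP #|G| w; last first.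
    exists T, (side_sep bag); apply: S_tree_of_td => // [t|s t e_st].
      have := leq_bigmax (F := fun t => #|bag t|) t; move: width_bag; rewrite /width; lia.
    apply: leq_ltn_trans adh_bag.
    by apply: (leq_bigmax_cond (F := fun p => #|bag p.1 :&: bag p.2|) (s, t)).
  (* With |V| < w the one-node tree works: its star is empty, with intersection V. The pair of empty
     sets is a dummy value, there being no edges. *)
  exists unit_graph, (fun _ _ => (set0, set0)); split=> //; first exact: unit_graph_tree.
  move=> t; rewrite [X in in_F _ _ X](_ : _ = set0).
    by split; rewrite ?sub0set ?big_set0 ?cardsT //; split=> [s|r s]; rewrite in_set0.
  by apply/setP => s; rewrite inE; apply/imsetP => -[x]; rewrite inE.
have no_td_tangle : ~ (exists (T : sgraph) (bag : T -> {set G}),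
        [/\ tree_decomposition bag,
            (width bag < w%:Z - 1)%R & adhesion bag < k]) ->
    exists O : {set sep G}, F_tangle w k O.
  (* If |V| < w, the single part V is already an excluded tree-decomposition; otherwise the duality
     applies, starting from the empty partial orientation. *)
  move=> no_td; have [lt_Gw|le_wG] := ltnP #|G| w.
    case: no_td; apply: (@td_of_rooted_td G w k [set: G]) => //.
    by apply: rooted_td_leaf; rewrite cardsT.
  have [||//|/rooted_td_of_decomposable[X td]] :=
    @tangle_or_decomposable G w k le_kw le_wG set0.
  - exact: sub0set.
  - by move=> r s; rewrite inE.
  by case: no_td; apply: td_of_rooted_td td.
split; split=> //; tauto.
Qed.
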